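(* Let $n\in\mathbb{N}$, let $\mathcal{C}$ be a class of Banach spaces, let $\mathcal{A}$ be a $\mathcal{C}$-admissible assignment (as defined in the context) which moreover satisfies: for every Banach space $E$, if $A_1,A_2\in\mathcal{A}(E)$, then there is $A\in\mathcal{A}(E)$ such that $A_1\cup A_2\subseteq A$. Let $\tau_{\mathcal{A}}$ be the corresponding $\mathcal{C}$-projective ideal topology. Let $\mathcal{I},\mathcal{I}_1,\dots,\mathcal{I}_n,\mathcal{J},\mathcal{J}_1,\dots,\mathcal{J}_n$ be operator ideals with $\mathcal{L}[\mathcal{I}_1,\dots,\mathcal{I}_n]\subseteq\overline{\mathcal{I}}^{\,\tau_{\mathcal{A}}}\circ\mathcal{L}$, and let $E_1,\dots,E_n$ be Banach spaces, one of them belonging to $\mathcal{C}$, such that $$\mathcal{J}\circ\mathcal{L}(E_1,\dots,E_n;E_1\widehat\otimes_\pi\cdots\widehat\otimes_\pi E_n)\subseteq\mathcal{J}_1\otimes\cdots\otimes\mathcal{J}_n(E_1,\dots,E_n;E_1\widehat\otimes_\pi\cdots\widehat\otimes_\pi E_n).$$ If $E_j$ has the $(\mathcal{J}_j,\mathcal{I}_j,\tau_{\mathcal{A}})$-WAP for $j=1,\dots,n$, then $E_1\widehat\otimes_\pi\cdots\widehat\otimes_\pi E_n$ has the $(\mathcal{J},\mathcal{I},\tau_{\mathcal{A}})$-WAP.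
   Context: All Banach spaces are over $\mathbb{K}=\mathbb{R}$ or $\mathbb{C}$. $\mathcal{L}(E;F)$, $\mathcal{L}(E_1,\dots,E_n;F)$ and $\mathcal{P}(^nE;F)$ are the spaces of bounded linear operators, continuous $n$-linear mappings and continuous $n$-homogeneous polynomials. $E_1\widehat\otimes_\pi\cdots\widehat\otimes_\pi E_n$ is the completed projective tensor product and $\widehat\otimes^n_{s,\pi}E$ the completed $n$-fold symmetric projective tensor product. For sets, $A_1\otimes\cdots\otimes A_n:=\{x_1\otimes\cdots\otimes x_n: x_j\in A_j\}$, $\otimes^n_sA:=\{x\otimes\cdots\otimes x: x\in A\}$; $\overline{\mathrm{co}}$ is the closed convex hull. Operator ideals are in the sense of Pietsch: each component $\mathcal{I}(E;F)$ is a linear subspace of $\mathcal{L}(E;F)$ containing the finite rank operators, and $w\circ v\circ u\in\mathcal{I}$ whenever $v\in\mathcal{I}$ and $u,w$ are bounded operators. A $\mathcal{C}$-admissible assignment $\mathcal{A}$ assigns to every Banach space $E$ a collection $\mathcal{A}(E)$ of bounded subsets of $E$ containing the singletons, such that $u(A)\in\mathcal{A}(F)$ for all Banach spaces $E,F$, $A\in\mathcal{A}(E)$, $u\in\mathcal{L}(E;F)$, and such that for all $n\in\mathbb{N}$ and Banach spaces $E_1,\dots,E_n,E$ with $E,E_j\in\mathcal{C}$ for some $j$: (i) every $A\in\mathcal{A}(E_1\widehat\otimes_\pi\cdots\widehat\otimes_\pi E_n)$ is contained in a finite union of sets $\overline{\mathrm{co}}(A_1\otimes\cdots\otimes A_n)$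 with $A_j\in\mathcal{A}(E_j)$, $j=1,\dots,n$; (ii) if $A_j\in\mathcal{A}(E_j)$ for $j=1,\dots,n$, there is $A\in\mathcal{A}(E_1\widehat\otimes_\pi\cdots\widehat\otimes_\pi E_n)$ with $A_1\otimes\cdots\otimes A_n\subseteq A$; (iii) every $A\in\mathcal{A}(\widehat\otimes^n_{s,\pi}E)$ is contained in a finite union of sets $\overline{\mathrm{co}}(\otimes^n_sA')$ with $A'\in\mathcal{A}(E)$; (iv) if $A\in\mathcal{A}(E)$, there is $A'\in\mathcal{A}(\widehat\otimes^n_{s,\pi}E)$ with $\otimes^n_sA\subseteq A'$. $\tau_{\mathcal{A}}$ is the topology on $\mathcal{L}(E;F)$ and $\mathcal{P}(^nE;F)$ of uniform convergence on sets of $\mathcal{A}(E)$, and on $\mathcal{L}(E_1,\dots,E_n;F)$ of uniform convergence on sets $A_1\times\cdots\times A_n$ with $A_j\in\mathcal{A}(E_j)$. $\overline{\mathcal{I}}^{\,\tau_{\mathcal{A}}}$ is the class with components $\overline{\mathcal{I}(E;F)}^{\,\tau_{\mathcal{A}}}$ (closure in $\mathcal{L}(E;F)$); it is an operator ideal for every operator ideal $\mathcal{I}$. For an operator ideal $\mathcal{I}$, $\mathcal{I}\circ\mathcal{L}(E_1,\dots,E_n;F)$ is the set of $n$-linear mappings of the form $u\circ B$ with $G$ a Banach space, $B\in\mathcal{L}(E_1,\dots,E_n;G)$ and $u\in\mathcal{I}(G;F)$. $\mathcal{L}[\mathcal{I}_1,\dots,\mathcal{I}_n](E_1,\dots,E_n;F)$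 is the set of $A\in\mathcal{L}(E_1,\dots,E_n;F)$ of the form $A=B\circ(u_1,\dots,u_n)$ with $G_1,\dots,G_n$ Banach spaces, $u_j\in\mathcal{I}_j(E_j;G_j)$ and $B\in\mathcal{L}(G_1,\dots,G_n;F)$. The inclusion $\mathcal{L}[\mathcal{I}_1,\dots,\mathcal{I}_n]\subseteq\overline{\mathcal{I}}^{\,\tau_{\mathcal{A}}}\circ\mathcal{L}$ means inclusion of components for all Banach spaces $E_1,\dots,E_n,F$. $\mathcal{J}_1\otimes\cdots\otimes\mathcal{J}_n(E_1,\dots,E_n;F)$ is the set of $A\in\mathcal{L}(E_1,\dots,E_n;F)$ of the form $A=B\circ(T_1,\dots,T_n)$ with $T_j\in\mathcal{J}_j(E_j;E_j)$ and $B\in\mathcal{L}(E_1,\dots,E_n;F)$. A Banach space $X$ has the $(\mathcal{J},\mathcal{I},\tau)$-weak approximation property ($(\mathcal{J},\mathcal{I},\tau)$-WAP) if $\mathcal{J}(X;X)\subseteq\overline{\mathcal{I}(X;X)}^{\,\tau}$. *)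

(* Defs.v *)
From HB Require Import structures.
From mathcomp Require Import all_boot all_order all_algebra.
From mathcomp Require Import complex.
From mathcomp Require Import all_classical all_reals all_analysis.

Set Implicit Arguments.
Unset Strict Implicit.
Unset Printing Implicit Defensive.
Import Order.TTheory GRing.Theory Num.Theory.
Import numFieldNormedType.Exports.
Local Open Scope classical_set_scope.
Local Open Scope ring_scope.

Variant scalar_kind := RealScalars | ComplexScalars.

Definition scalars (R : realType) (k : scalar_kind) : numFieldType :=
  match k with RealScalars => R | ComplexScalars => R[i] end.

Notation banach := completeNormedModType.

(* The norm of a Banach space over K takes its values in (the nonnegative reals
   of) K, so in the complex case every inequality between norms below is the
   order of R[i], which forces both of its sides to be real as soon as one is. *)

Section Mappings.
Variable K : numFieldType.

Definition bounded_op (E F : banach K) : set (E -> F) :=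
  [set u | linear u /\ exists M : K, forall x, `|u x| <= M * `|x|].

Definition finite_rank (E F : banach K) : set (E -> F) :=
  [set u | exists m (y : 'I_m -> F),
     forall x, exists c : 'I_m -> K, u x = \sum_(i < m) c i *: y i].

Definition multilinear n (E : 'I_n -> banach K) (W : lmodType K)
    (B : (forall j, E j) -> W) : Prop :=
  forall (x : forall j, E j) (j : 'I_n) (a : K) (u v : E j),
    B (dfwith x j (a *: u + v)) = a *: B (dfwith x j u) + B (dfwith x j v).

Definition cont_multilinear n (E : 'I_n -> banach K) (F : banach K) :
    set ((forall j, E j) -> F) :=
  [set B | multilinear B /\ continuous (B : prod_topology E -> F)].

Definition convex_hull (E : banach K) (A : set E) : set E :=
  [set z | exists m (t : 'I_m -> K) (x : 'I_m -> E),
     [/\ forall i, 0 <= t i, \sum_(i < m) t i = 1, forall i, A (x i)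
       & z = \sum_(i < m) t i *: x i]].

Definition closed_convex_hull (E : banach K) (A : set E) : set E :=
  closure (convex_hull A).

End Mappings.

(* Completed projective tensor products are described by the data (T, phi),
   T a Banach space and phi the mapping (x_1, ..., x_n) |-> x_1 (x) ... (x) x_n
   into it: T is the completion of the algebraic tensor product, spanned by
   phi, for the projective norm.  These data are unique up to an isometric
   isomorphism.  An element of the algebraic tensor product is represented by a
   formal sum, that is, a finite list of pairs (coefficient, generator). *)
Section Tensor.
Variable K : numFieldType.

Definition formal_eval (X : Type) (W : lmodType K) (f : X -> W)
    (s : seq (K * X)) : W :=
  \sum_(p <- s) p.1 *: f p.2.

(* By the universal property of the algebraic tensor product, two formal sums
   of elementary tensors are equal in it exactly when every multilinear mapping
   into a vector space takes the same value on them. *)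
Definition tensor_eq n (E : 'I_n -> banach K)
    (s t : seq (K * (forall j, E j))) : Prop :=
  forall (W : lmodType K) (B : (forall j, E j) -> W),
    multilinear B -> formal_eval B s = formal_eval B t.

Definition is_proj_tensor n (E : 'I_n -> banach K) (T : banach K)
    (phi : (forall j, E j) -> T) : Prop :=
  [/\ multilinear phi,
      forall s, infimums
        [set \sum_(p <- t) `|p.1| * \prod_(j < n) `|p.2 j|
          | t in [set t | tensor_eq s t]] `|formal_eval phi s|
    & closure (range (formal_eval phi)) = setT].

(* Equality in the n-fold algebraic tensor product of the formal sums
   \sum_p p.1 (p.2 (x) ... (x) p.2). *)
Definition sym_tensor_eq n (E : banach K) (s t : seq (K * E)) : Prop :=
  let diag := map (fun p : K * E => (p.1, fun _ : 'I_n => p.2)) in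
  tensor_eq (diag s) (diag t).

(* delta is x |-> x (x) ... (x) x, whose values span the algebraic symmetric
   tensor product. *)
Definition is_sym_proj_tensor n (E S : banach K) (delta : E -> S) : Prop :=
  [/\ forall s t, sym_tensor_eq n s t ->
        formal_eval delta s = formal_eval delta t,
      forall s, infimums
        [set \sum_(p <- t) `|p.1| * `|p.2| ^+ n
          | t in [set t | sym_tensor_eq n s t]] `|formal_eval delta s|
    & closure (range (formal_eval delta)) = setT].

Definition tensor_set n (E : 'I_n -> banach K) (T : banach K)
    (phi : (forall j, E j) -> T) (A : forall j, set (E j)) : set T :=
  phi @` [set x | forall j, A j (x j)].

End Tensor.

Section Ideals.
Variable K : numFieldType.

Definition op_class := forall E F : banach K, set (E -> F).

Record operator_ideal (I : op_class) : Prop := {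
  ideal_bounded : forall E F : banach K, I E F `<=` @bounded_op K E F;
  ideal_comb : forall (E F : banach K) (a : K) (u v : E -> F),
    I E F u -> I E F v -> I E F (fun x => a *: u x + v x);
  ideal_finite_rank : forall E F : banach K,
    @bounded_op K E F `&` @finite_rank K E F `<=` I E F;
  ideal_comp : forall (E0 E F F0 : banach K)
      (u : E0 -> E) (v : E -> F) (w : F -> F0),
    bounded_op u -> I E F v -> bounded_op w -> I E0 F0 (w \o v \o u)
}.

Definition comp_ideal (J : op_class) n (E : 'I_n -> banach K) (F : banach K) :
    set ((forall j, E j) -> F) :=
  [set A | exists (G : banach K) (B : (forall j, E j) -> G) (u : G -> F),
     [/\ cont_multilinear B, J G F u & A = u \o B]].

Definition factor_ideal n (I : 'I_n -> op_class)
    (E : 'I_n -> banach K) (F : banach K) : set ((forall j, E j) -> F) :=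
  [set A | exists (G : 'I_n -> banach K) (u : forall j, E j -> G j)
                  (B : (forall j, G j) -> F),
     [/\ forall j, I j (E j) (G j) (u j), cont_multilinear B
       & A = fun x => B (fun j => u j (x j))]].

Definition tensor_ideal n (J : 'I_n -> op_class)
    (E : 'I_n -> banach K) (F : banach K) : set ((forall j, E j) -> F) :=
  [set A | exists (t : forall j, E j -> E j) (B : (forall j, E j) -> F),
     [/\ forall j, J j (E j) (E j) (t j), cont_multilinear B
       & A = fun x => B (fun j => t j (x j))]].

End Ideals.

Section Assignments.
Variable K : numFieldType.

Definition assignment := forall E : banach K, set (set E).

Record admissible (C : banach K -> Prop) (A : assignment) : Prop := {
  adm_bounded : forall E : banach K, A E `<=` bounded_set;
  adm_singleton : forall (E : banach K) (x : E), A E [set x];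
  adm_image : forall (E F : banach K) (D : set E) (u : E -> F),
    A E D -> bounded_op u -> A F (u @` D);
  adm_tensor_sub : forall n (E : 'I_n -> banach K) (T : banach K)
      (phi : (forall j, E j) -> T),
    (exists j, C (E j)) -> is_proj_tensor phi ->
    forall D, A T D ->
      exists m (D' : 'I_m -> forall j, set (E j)),
        (forall i j, A (E j) (D' i j)) /\
        D `<=` \bigcup_i closed_convex_hull (tensor_set phi (D' i));
  adm_tensor_sup : forall n (E : 'I_n -> banach K) (T : banach K)
      (phi : (forall j, E j) -> T),
    (exists j, C (E j)) -> is_proj_tensor phi ->
    forall D : forall j, set (E j), (forall j, A (E j) (D j)) ->
      exists2 D', A T D' & tensor_set phi D `<=` D';
  adm_sym_sub : forall n (E S : banach K) (delta : E -> S),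
    (0 < n)%N -> C E -> is_sym_proj_tensor n delta ->
    forall D, A S D ->
      exists m (D' : 'I_m -> set E),
        (forall i, A E (D' i)) /\
        D `<=` \bigcup_i closed_convex_hull (delta @` D' i);
  adm_sym_sup : forall n (E S : banach K) (delta : E -> S),
    (0 < n)%N -> C E -> is_sym_proj_tensor n delta ->
    forall D, A E D -> exists2 D', A S D' & delta @` D `<=` D'
}.

(* The closure in the space of bounded operators, for the topology of uniform
   convergence on the sets of A E. *)
Definition tau_closure (A : assignment) (I : op_class K) : op_class K :=
  fun E F => @bounded_op K E F `&`
    closure (I E F : set {family A E, E -> F}).

Definition WAP (J I : op_class K) (A : assignment) (X : banach K) : Prop :=
  J X X `<=` tau_closure A I (E := X) (F := X).

End Assignments.

(* Main.v *)
Require Import Defs.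
From mathcomp Require Import all_boot all_order all_algebra.
From mathcomp Require Import all_classical all_reals all_analysis.
Local Open Scope classical_set_scope.

Import Order.TTheory GRing.Theory Num.Theory.
Import numFieldNormedType.Exports.
Local Open Scope ring_scope.

(* Let v be in J(T;T), T the projective tensor product.  Then v o phi belongs
   to J o L, hence equals B o (t_1, ..., t_n) with t_j in J_j(E_j;E_j).
   Approximating each t_j by some u_j in I_j uniformly on a set of A(E_j)
   approximates B o (t_1, ..., t_n) by B o (u_1, ..., u_n), which by hypothesis
   equals w o B' with w in the tau-closure of I.  Linearizing B' = L o phi, the
   operators v and w o L are close on elementary tensors over sets of the
   assignment, hence on the closed convex hulls of those, which cover every
   set of A(T); finally w is close on L(D) to an operator of I. *)

Lemma dfwith_id {I : eqType} {T : I -> Type} (f : forall i, T i) (i : I) :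
  dfwith f i (f i) = f.
Proof. by apply: functional_extensionality_dep => j; case: dfwithP. Qed.

(** * Multilinear mappings: boundedness and continuity *)

Section Multilinear.
Context {K : numFieldType} {n : nat} {E : 'I_n -> banach K}.

Section Algebra.
Context {W : lmodType K} {B : (forall j, E j) -> W}.
Hypothesis mB : multilinear B.

Lemma multilinear0 (x : forall j, E j) j : B (dfwith x j 0) = 0.
Proof.
by have := mB x j (-1) 0 0; rewrite scaler0 addr0 scaleN1r addNr.
Qed.

Lemma multilinearZ (x : forall j, E j) j a u :
  B (dfwith x j (a *: u)) = a *: B (dfwith x j u).
Proof. by have := mB x j a u 0; rewrite addr0 multilinear0 addr0. Qed.

Lemma multilinearB (x : forall j, E j) j u v :
  B (dfwith x j (u - v)) = B (dfwith x j u) - B (dfwith x j v).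
Proof. by have := mB x j (-1) v u; rewrite !scaleN1r addrC => ->; rewrite addrC. Qed.

Lemma multilinear_eq0 (x : forall j, E j) j : x j = 0 -> B x = 0.
Proof. by move=> xj; rewrite -(dfwith_id x j) xj multilinear0. Qed.

(** Induction over a duplicate-free list of the coordinates already scaled. *)
Lemma multilinear_scale (a : 'I_n -> K) (x : forall j, E j) :
  B (fun j => a j *: x j) = (\prod_j a j) *: B x.
Proof.
suff H (s : seq 'I_n) : uniq s ->
    B (fun j => if j \in s then a j *: x j else x j) = (\prod_(j <- s) a j) *: B x.
  rewrite -(H _ (index_enum_uniq _)); congr B.
  by apply: functional_extensionality_dep => j; rewrite mem_index_enum.
elim: s => [_|i s IH /= /andP[si us]].
  by rewrite big_nil scale1r; congr B; apply: functional_extensionality_dep.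
rewrite big_cons -scalerA -IH//.
set h := (X in _ = _ *: B X); rewrite -[in RHS](dfwith_id h i) -multilinearZ.
congr B; apply: functional_extensionality_dep => j; case: dfwithP => [|k].
  by rewrite mem_head /h (negbTE si).
by rewrite in_cons eq_sym => /negbTE ->.
Qed.

End Algebra.

Section Norm.
Context {F : normedModType K} {B : (forall j, E j) -> F}.
Hypothesis mB : multilinear B.
Variable M : K.
Hypothesis M0 : 0 < M.
Hypothesis BM : forall x, `|B x| <= M * \prod_j `|x j|.

(* Replace the coordinates of y by those of x one at a time: each replacement
   moves the value of B by at most M e r^n. *)
Lemma multilinear_dist (r e : K) (x y : forall j, E j) : 1 <= r ->
    (forall j, `|x j| <= r) -> (forall j, `|y j| <= r) ->
    (forall j, `|x j - y j| <= e) ->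
  `|B x - B y| <= n%:R * (M * (e * r ^+ n)).
Proof.
move=> r1 xr yr xye.
have r0 : 0 <= r by rewrite (le_trans _ r1).
suff H (s : seq 'I_n) : uniq s ->
    `|B (fun j => if j \in s then x j else y j) - B y| <=
    (size s)%:R * (M * (e * r ^+ n)).
  have := H _ (enum_uniq 'I_n); rewrite size_enum_ord.
  congr (`|B _ - _| <= _).
  by apply: functional_extensionality_dep => j; rewrite mem_enum.
elim: s => [_|i s IH /= /andP[si us]].
  by rewrite mul0r; set f := fun _ => _; rewrite (_ : f = y) ?subrr ?normr0//.
set g := fun _ => _; set h := fun j => if j \in s then x j else y j.
have gE : g = dfwith h i (x i).
  apply: functional_extensionality_dep => j; case: dfwithP => [|k].
    by rewrite /g mem_head.
  by rewrite /g in_cons eq_sym => /negbTE ->.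
have hE : h = dfwith h i (y i).
  by rewrite -[LHS](dfwith_id h i) {2}/h (negbTE si).
rewrite -[B g](subrK (B h)) -addrA (le_trans (ler_normD _ _))//.
rewrite -add1n natrD mulrDl mul1r lerD ?IH//.
rewrite gE {2}hE -multilinearB// (le_trans (BM _))//.
rewrite ler_pM2l// (bigD1 i)//= dfwithin.
rewrite ler_pM ?prodr_ge0//.
have hr j : `|dfwith h i (x i - y i) j| <= (if j == i then e else r).
  case: dfwithP => [|k]; first by rewrite eqxx.
  by rewrite eq_sym => /negbTE ->; rewrite /h; case: ifP.
apply: (@le_trans _ _ (\prod_(j < n | j != i) r)).
  apply: ler_prod => j ji; rewrite normr_ge0/=.
  by have := hr j; rewrite (negbTE ji).
(* At most [n] factors are left, and [1 <= r] lets the exponent be raised to [n]. *)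
rewrite prodr_const; apply: ler_weXn2l => //.
by rewrite (leq_trans (max_card _))// card_ord.
Qed.

(** Near [x] all coordinates stay below one [r], where [multilinear_dist] is a Lipschitz
    estimate. *)
Lemma bounded_multilinear_continuous : continuous (B : prod_topology E -> F).
Proof.
move=> x.
have FF : Filter (nbhs (x : prod_topology E)) by exact: nbhs_filter.
apply/cvgrPdist_lt => e e0.
(* [r] dominates the coordinates of [x] and of every [y] within distance 1; a sum replaces the
   maximum, the order of [K] being only partial. *)
pose r : K := 1 + \sum_j (`|x j| + 1).
have r1 : 1 <= r by rewrite lerDl sumr_ge0.
have xr j : `|x j| + 1 <= r.
  by rewrite /r (bigD1 j)//= addrCA lerDl addr_ge0// sumr_ge0.
(* The summand 1 keeps [c] positive and makes the final estimate strict. *)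
pose c := n%:R * (M * r ^+ n) + 1.
have r0 : 0 < r by rewrite (lt_le_trans _ r1).
have c0 : 0 < c by rewrite ltr_wpDl// mulr_ge0// mulr_ge0 ?ltW// exprn_gt0.
have near_proj (d : K) : 0 < d ->
    \forall y \near (x : prod_topology E), forall j, `|x j - y j| < d.
  move=> d0.
  apply: (@filter_forall _ _ (fun j => [set y | `|x j - y j| < d]) _ FF) => j.
  have := @proj_continuous _ (E : _ -> topologicalType) j x.
  move=> /(_ [set z | `|x j - z| < d]); apply.
  by apply/nbhs_ballP; exists d => //= z; rewrite -ball_normE.
have ec0 : 0 < e / c by rewrite divr_gt0.
apply: filterS2 (near_proj _ ltr01) (near_proj _ ec0) => y y1 ye.
apply: (@le_lt_trans _ _ (n%:R * (M * (e / c * r ^+ n)))).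
  apply: multilinear_dist => // j.
  - by rewrite (le_trans _ (xr j))// lerDl.
  - rewrite (le_trans _ (xr j))// -lerBlDl (le_trans (lerB_dist _ _))//.
    by rewrite distrC ltW.
  - exact/ltW.
rewrite -(mulrA e) (mulrCA M) (mulrCA _ e) gtr_pMr//.
rewrite (mulrCA M) (mulrCA _ c^-1) ltr_pdivrMl// mulr1 /c ltrDl//.
Qed.

End Norm.

(** Continuity at 0 yields a box on which [B] has norm below 1; scaling [x] into this box coordinate
    by coordinate gives the bound. *)
Lemma continuous_multilinear_bounded {F : normedModType K}
    {B : (forall j, E j) -> F} :
    (0 < n)%N -> multilinear B -> continuous (B : prod_topology E -> F) ->
  exists2 M : K, 0 < M & forall x, `|B x| <= M * \prod_j `|x j|.
Proof.
move=> n0 mB cB; pose z : prod_topology E := fun j => 0 : E j.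
(* The filter generated by the open boxes around 0; its convergence to [z] says that every
   neighbourhood of 0 contains such a box. *)
pose G : set_system (prod_topology E) :=
  [set P | exists2 d : 'I_n -> K, forall j, 0 < d j &
    [set x | forall j, `|x j| < d j] `<=` P].
have GF : Filter G.
  split.
  - by exists (fun=> 1).
  - move=> P Q [d d0 dP] [d' d'0 dQ].
    exists (fun j => Num.min (d j) (d' j)) => [j|x xd].
      by rewrite comparable_lt_min ?d0 ?d'0// real_comparable ?gtr0_real.
    split; [apply: dP|apply: dQ] => j; move: (xd j);
      by rewrite comparable_lt_min ?real_comparable ?gtr0_real// => /andP[].
  - by move=> P Q PQ [d d0 dP]; exists d => //; exact: subset_trans PQ.
have Gz : G --> z.
  apply/cvg_sup => j; apply/cvg_image.
    by apply/seteqP; split => // y _; exists (dfwith z j y); rewrite ?dfwithin.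
  move=> P /nbhs_ballP[d /= d0 dP].
  exists [set x | P (x j)]; last first.
    apply/seteqP; split => [y [x Px <-]//|y Py].
    by exists (dfwith z j y) => //=; rewrite dfwithin.
  exists (fun=> d) => // x xd; apply: dP.
  by rewrite -ball_normE /= /z sub0r normrN; exact: xd.
have Bz : B z = 0 by exact: (multilinear_eq0 mB z (Ordinal n0)).
have [d d0 dB] : G [set x | `|B x| < 1].
  have := cB z; rewrite /continuous_at Bz => h.
  apply: Gz; apply: (h [set y | `|y| < 1]); exact: nbhs0_lt.
(* Nonzero coordinates will be scaled to norm [d j / 2], strictly inside the box. *)
pose a := \prod_j (2 / d j).
have a0 : 0 < a by apply: prodr_gt0 => j _; rewrite divr_gt0.
exists a => // x.
have [[j xj]|xN0] := pselect (exists j, x j = 0).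
  rewrite (multilinear_eq0 mB _ _ xj) normr0; apply: mulr_ge0; first exact: ltW.
  exact: prodr_ge0.
have x0 j : 0 < `|x j|.
  by rewrite normr_gt0; apply/eqP => xj; apply: xN0; exists j.
have p0 : 0 < \prod_j `|x j| by apply: prodr_gt0.
have := dB (fun j => (d j / (2 * `|x j|)) *: x j).
rewrite /= multilinear_scale// normrZ => H.
have {}H : `|\prod_j (d j / (2 * `|x j|))| * `|B x| < 1.
  apply: H => j; rewrite normrZ gtr0_norm; last first.
    by rewrite divr_gt0// mulr_gt0.
  rewrite invfM mulrA divfK ?gt_eqF//.
  by rewrite ltr_pdivrMr// ltr_pMr// ltr1n.
move: H; rewrite gtr0_norm; last first.
  by apply: prodr_gt0 => j _; rewrite divr_gt0// mulr_gt0.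
rewrite mulrC -ltr_pdivlMr; last first.
  by apply: prodr_gt0 => j _; rewrite divr_gt0// mulr_gt0.
move/ltW; rewrite mul1r -prodfV -big_split/=.
by under eq_bigr do rewrite invf_div -mulrAC.
Qed.
End Multilinear.

(** * Extension from formal sums to the completed space *)

Section FormalEval.
Context {K : numFieldType} {X : Type}.

Lemma formal_eval_cat {W : lmodType K} (f : X -> W) s t :
  formal_eval f (s ++ t) = formal_eval f s + formal_eval f t.
Proof. by rewrite /formal_eval big_cat. Qed.

Lemma formal_eval_scale {W : lmodType K} (f : X -> W) a s :
  formal_eval f [seq (a * p.1, p.2) | p <- s] = a *: formal_eval f s.
Proof.
by rewrite /formal_eval big_map scaler_sumr; apply: eq_bigr => p _; rewrite scalerA.
Qed.

Lemma formal_eval1 {W : lmodType K} (f : X -> W) x :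
  formal_eval f [:: (1, x)] = f x.
Proof. by rewrite /formal_eval big_seq1 scale1r. Qed.

Context {T G : banach K} {f : X -> T} {g : X -> G} {M : K}.
Hypothesis M0 : 0 < M.
Hypothesis fg : forall s, `|formal_eval g s| <= M * `|formal_eval f s|.
Hypothesis f_dense : closure (range (formal_eval f)) = setT.

(* The extension L is the closure of the graph f x |-> g x, which avoids
   choosing sequences in T. *)
Let graph (z : T) (y : G) := forall e : K, 0 < e ->
  exists2 s, `|z - formal_eval f s| < e & `|y - formal_eval g s| < e.

(** The neighbourhoods of [z] are transported along formal sums to a filter [H] on [G]: density
    makes it proper, [fg] makes it Cauchy, and its limit is the required [y]. *)
Let graph_total z : exists y, graph z y.
Proof.
pose H : set_system G := [set P | exists2 U : set T, nbhs z U &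
  forall s, U (formal_eval f s) -> P (formal_eval g s)].
have HF : ProperFilter H.
  split; last first.
    split.
    - by exists setT => //; exact: filterT.
    - move=> P Q [U zU UP] [V zV VQ]; exists (U `&` V); first exact: filterI.
      by move=> s [/UP ? /VQ].
    - by move=> P Q PQ [U zU UP]; exists U => // s /UP /PQ.
  move=> [U zU U0].
  have : closure (range (formal_eval f)) z by rewrite f_dense.
  by move=> /(_ _ zU)[_ [[s _ <-]] /U0].
have /cauchy_cvg : cauchy H.
  apply/cauchyP => e e0.
  (* Two formal sums this close to [z] differ by less than [e / M] under [f], hence by less than [e]
     under [g]. *)
  have d0 : 0 < M^-1 * e / 2 by rewrite divr_gt0// mulr_gt0// invr_gt0.
  have : closure (range (formal_eval f)) z by rewrite f_dense.
  move=> /(_ _ (nbhsx_ballx z _ d0))[_ [[s _ <-]]].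
  rewrite -ball_normE /= => zs; exists (formal_eval g s).
  exists (ball z (M^-1 * e / 2)); first exact: nbhsx_ballx.
  move=> t; rewrite -!ball_normE /= => zt.
  rewrite -scaleN1r -formal_eval_scale -formal_eval_cat.
  rewrite (le_lt_trans (fg _))// formal_eval_cat formal_eval_scale scaleN1r.
  rewrite -ltr_pdivlMl// (splitr (M^-1 * e)).
  by rewrite (le_lt_trans (ler_distD z _ _))// distrC ltrD.
case/cvg_ex => /= y Hy; exists y => e e0.
have [U zU UP] : H [set y' | `|y - y'| < e].
  by apply: Hy; apply/nbhs_ballP; exists e => //= y'; rewrite -ball_normE.
have : closure (range (formal_eval f)) z by rewrite f_dense.
move=> /(_ _ (filterI zU (nbhsx_ballx z _ e0)))[_ [[s _ <-]] [Us]].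
by rewrite -ball_normE /= => zs; exists s => //; exact: UP.
Qed.

Let graph_lin a z z' y y' : graph z y -> graph z' y' ->
  graph (a *: z + z') (a *: y + y').
Proof.
move=> zy zy' e e0.
(* The error [e] is shared between [a *: z] and [z'] in the ratio [|a|] to 1. *)
have a0 : 0 < `|a| + 1 by rewrite ltr_wpDl.
have d0 : 0 < e / (`|a| + 1) by rewrite divr_gt0.
have [s zs ys] := zy _ d0; have [t zt yt] := zy' _ d0.
have key (V : banach K) (h : X -> V) (u v : V) :
    `|u - formal_eval h s| < e / (`|a| + 1) ->
    `|v - formal_eval h t| < e / (`|a| + 1) ->
    `|a *: u + v - formal_eval h ([seq (a * p.1, p.2) | p <- s] ++ t)| < e.
  move=> us vt.
  rewrite formal_eval_cat formal_eval_scale opprD addrACA -scalerBr.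
  rewrite (le_lt_trans (ler_normD _ _))// normrZ.
  rewrite -[ltRHS](divfK (lt0r_neq0 a0)) mulrDr mulr1 [_ / _ * `|a|]mulrC.
  by rewrite ler_ltD// ler_wpM2l// ltW.
by exists ([seq (a * p.1, p.2) | p <- s] ++ t); exact: key.
Qed.

Let graph_bound z y : graph z y -> `|y| <= M * `|z|.
Proof.
move=> zy; apply/ler_addgt0Pr => e e0.
(* One share of [e / (M + 1)] pays for approximating [y], and [M] shares for approximating [z]
   through [fg]. *)
have M1 : 0 < M + 1 by rewrite addr_gt0.
have [s zs ys] := zy (e / (M + 1)) (divr_gt0 e0 M1).
have ze : `|formal_eval f s| <= `|z| + e / (M + 1).
  by rewrite addrC -lerBlDr (le_trans (lerB_dist _ _))// distrC ltW.
rewrite -[y](subrK (formal_eval g s)) (le_trans (ler_normD _ _))//.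
rewrite -[e in leRHS](divfK (lt0r_neq0 M1)) mulrDr mulr1 addrA [leRHS]addrC.
rewrite lerD ?(ltW ys)// [_ * M]mulrC -mulrDr (le_trans (fg _))//.
by rewrite ler_wpM2l// ltW.
Qed.

(** The graph is single-valued: by linearity the difference of two values over [z] lies over 0,
    where [graph_bound] forces it to vanish. *)
Lemma formal_eval_extension :
  exists L : T -> G, bounded_op L /\ forall x, L (f x) = g x.
Proof.
have graph_unique z y y' : graph z y -> graph z y' -> y = y'.
  move=> zy zy'; have /graph_bound := graph_lin (-1) _ _ _ _ zy zy'.
  rewrite !scaleN1r addNr normr0 mulr0 normr_le0 addrC subr_eq0.
  by move=> /eqP.
have [L LP] := choice graph_total.
exists L; split; first split.
- move=> a u v; apply: (graph_unique (a *: u + v)) => //.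
  exact: graph_lin.
- by exists M => x; exact: graph_bound.
- move=> x; apply: (graph_unique (f x)) => // e e0.
  by exists [:: (1, x)]; rewrite formal_eval1 subrr normr0.
Qed.

End FormalEval.

(** * Universal property of the projective tensor product *)

Section ProjTensor.
Context {K : numFieldType} {n : nat} {E : 'I_n -> banach K} {T : banach K}.
Context {phi : (forall j, E j) -> T}.
Hypothesis hT : is_proj_tensor phi.

(** The one-term formal sum is among the representations over which the infimum is taken. *)
Lemma proj_tensor_norm (x : forall j, E j) : `|phi x| <= \prod_j `|x j|.
Proof.
have [_ /(_ [:: (1, x)])[+ _] _] := hT; rewrite formal_eval1; apply.
by exists [:: (1, x)]; [move=> W B _|rewrite big_seq1 normr1 mul1r].
Qed.

Lemma proj_tensor_continuous : cont_multilinear phi.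
Proof.
have mphi : multilinear phi by case: hT.
split => //; apply: (bounded_multilinear_continuous mphi _ (ltr01 : 0 < 1 :> K)).
by move=> x; rewrite mul1r proj_tensor_norm.
Qed.

(** The bound on [B] applies to every representation [t] of [s], so it passes to the infimum, which
    is the norm of [formal_eval phi s]. *)
Lemma proj_tensor_linearization {G : banach K} (B : (forall j, E j) -> G) :
  (0 < n)%N -> cont_multilinear B ->
  exists L : T -> G, bounded_op L /\ forall x, L (phi x) = B x.
Proof.
move=> n0 [mB /(continuous_multilinear_bounded n0 mB)[M M0 BM]].
have [mphi phi_norm phi_dense] := hT.
apply: (formal_eval_extension M0) => // s.
rewrite -ler_pdivrMl//; have [_] := phi_norm s; apply => _ [t st <-].
rewrite ler_pdivrMl// (st _ _ mB) (le_trans (ler_norm_sum _ _ _))//.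
rewrite mulr_sumr; apply: ler_sum => p _.
by rewrite normrZ mulrCA ler_wpM2l.
Qed.

End ProjTensor.

(** * Bounded operators and closed convex hulls *)

Section BoundedOp.
Context {K : numFieldType}.

(** A nonzero vector forces the given constant to be nonnegative; on the zero space any positive
    constant serves. *)
Lemma bounded_op_gt0 {E F : banach K} {u : E -> F} : bounded_op u ->
  exists2 M : K, 0 < M & forall x, `|u x| <= M * `|x|.
Proof.
move=> [_ [M uM]].
have [[x x0]|E0] := pselect (exists x : E, x != 0).
  have nx : 0 < `|x| by rewrite normr_gt0.
  have M0 : 0 <= M by rewrite -(pmulr_lge0 _ nx) (le_trans _ (uM x)).
  exists (M + 1) => [|y]; first by rewrite ltr_wpDl.
  by rewrite (le_trans (uM y))// ler_wpM2r// lerDl.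
exists 1 => // x; have -> : x = 0.
  by apply/eqP/negPn/negP => x0; apply: E0; exists x.
by rewrite (le_trans (uM 0))// normr0 !mulr0.
Qed.

Lemma bounded_op_id {E : banach K} : bounded_op (@id E).
Proof. by split=> //; exists 1 => x; rewrite mul1r. Qed.

Lemma bounded_op_comp {E F G : banach K} {u : E -> F} {w : F -> G} :
  bounded_op u -> bounded_op w -> bounded_op (w \o u).
Proof.
move=> bu bw.
have [M _ uM] := bounded_op_gt0 bu; have [N N0 wN] := bounded_op_gt0 bw.
case: bu bw => [lu _] [lw _]; split => [a x y /=|]; first by rewrite lu lw.
exists (N * M) => x /=; rewrite (le_trans (wN _))// -mulrA.
by rewrite ler_wpM2l// ltW.
Qed.

Lemma bounded_op_sub {E F : banach K} {u v : E -> F} :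
  bounded_op u -> bounded_op v -> bounded_op (fun x => u x - v x).
Proof.
move=> [lu [M uM]] [lv [N vN]]; split => [a x y|].
  by rewrite lu lv opprD addrACA scalerBr.
exists (M + N) => x; rewrite (le_trans (ler_normB _ _))// mulrDl.
exact: lerD.
Qed.

Lemma linear_comb {E F : banach K} {u : E -> F} m (t : 'I_m -> K) (x : 'I_m -> E) :
  linear u -> u (\sum_i t i *: x i) = \sum_i t i *: u (x i).
Proof.
move=> lu; have u0 : u 0 = 0.
  by have := lu (-1) 0 0; rewrite scaler0 addr0 scaleN1r addNr.
by elim/big_rec2: _ => // i y z _ <-; rewrite lu.
Qed.

(** Convex combinations preserve the bound [e], and passing to the closure costs an arbitrarily
    small [d] by continuity of [u]. *)
Lemma bounded_op_hull {E F : banach K} {u : E -> F} {D : set E} {e : K} :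
    bounded_op u -> (forall x, D x -> `|u x| <= e) ->
  forall z, closed_convex_hull D z -> `|u z| <= e.
Proof.
move=> bu uD z Dz; have [M M0 uM] := bounded_op_gt0 bu.
have [lu _] := bu.
apply/ler_addgt0Pr => d d0.
have [_ [[m [t [x [t0 t1 xD ->]]]]]] := Dz _ (nbhsx_ballx z _ (divr_gt0 d0 M0)).
rewrite -ball_normE /= => zx.
set y := \sum_i _ in zx.
have -> : u z = u y + u (z - y).
  have := lu 1 (z - y) y; rewrite !scale1r subrK => ->.
  by rewrite addrC.
rewrite (le_trans (ler_normD _ _))// lerD//; last first.
  by rewrite (le_trans (uM _))// mulrC -ler_pdivlMr// ltW.
rewrite linear_comb// (le_trans (ler_norm_sum _ _ _))//.
rewrite -[e]mul1r -t1 mulr_suml ler_sum// => i _.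
by rewrite normrZ ger0_norm// ler_wpM2l// uD.
Qed.

End BoundedOp.

(** * The closure expressed by approximation on single sets of the assignment *)

Section TauClosure.
Context {K : numFieldType} {A : assignment K} {I : op_class K} {E F : banach K}.

Lemma tau_closure_approx {f : E -> F} {D : set E} {e : K} :
    tau_closure A I f -> A E D -> 0 < e ->
  exists2 g, I E F g & forall x, D x -> `|f x - g x| < e.
Proof.
move=> [_ cf] AD e0.
have := fam_nbhs (f : {family A E, E -> F}) (entourage_ball F (PosNum e0)) AD.
move=> /cf[g [Ig fg]]; exists g => // x /fg /=.
by rewrite -ball_normE.
Qed.

Lemma approx_tau_closure {f : E -> F} :
    (exists D, A E D) ->
    (forall D1 D2, A E D1 -> A E D2 -> exists2 D, A E D & D1 `|` D2 `<=` D) ->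
    bounded_op f ->
    (forall D e, A E D -> 0 < e ->
      exists2 g, I E F g & forall x, D x -> `|f x - g x| < e) ->
  tau_closure A I f.
Proof.
move=> [D0 AD0] dir bf fI; split => //; rewrite closureEcvg.
(* The filter generated by the operators of [I E F] that are [e]-close to [f] on [D]; directedness
   makes it stable under intersection, and it converges to [f]. *)
pose filt : set_system (E -> F) := [set P | exists D e, [/\ A E D, 0 < e &
  forall g, I E F g -> (forall x, D x -> `|f x - g x| < e) -> P g]].
have HF : ProperFilter filt.
  split.
    by move=> [D [e [AD e0 DP]]]; have [g Ig /(DP _ Ig)] := fI _ _ AD e0.
  split.
  - by exists D0, 1; split.
  - move=> P Q [D1 [e1 [AD1 e10 P1]]] [D2 [e2 [AD2 e20 Q2]]].
    have [D AD DD] := dir _ _ AD1 AD2; exists D, (Num.min e1 e2).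
    have e12 : (e1 >=< e2)%O by rewrite real_comparable ?gtr0_real.
    rewrite comparable_lt_min// e10 e20; split => // g Ig gD.
    split; [apply: P1|apply: Q2] => // x Dx;
      have := gD x (DD x _); rewrite comparable_lt_min// => H.
      by have /andP[] := H (or_introl Dx).
    by have /andP[] := H (or_intror Dx).
  - move=> P Q PQ [D [e [AD e0 H]]]; exists D, e; split => // g Ig gD.
    exact/PQ/H.
exists filt => //; split; last first.
  by move=> P IP; exists D0, 1; split => // g Ig _; exact: IP.
apply/fam_cvgP => D AD P /uniform_nbhs[V [entV VP]].
move: entV; rewrite -entourage_ballE => -[e /= e0 eV].
exists D, e; split => // g Ig gD; apply: VP => x Dx.
by apply: eV => /=; rewrite -ball_normE; exact: gD.
Qed.

End TauClosure.

(** * Approximation of multilinear mappings through their factors *)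

Section Approximation.
Context {K : numFieldType} {n : nat} {E : 'I_n -> banach K}.
Context {C : banach K -> Prop} {A : assignment K}.
Hypothesis hA : admissible C A.

Lemma factor_ideal_approx {In : 'I_n -> op_class K} {F : banach K}
    {B : (forall j, E j) -> F} {t : forall j, E j -> E j}
    {D : forall j, set (E j)} {e : K} :
    (0 < n)%N -> cont_multilinear B ->
    (forall j, tau_closure A (In j) (E := E j) (F := E j) (t j)) ->
    (forall j, A (E j) (D j)) -> 0 < e ->
  exists2 b, @factor_ideal K n In E F b & forall x, (forall j, D j (x j)) ->
    `|B (fun j => t j (x j)) - b x| <= e.
Proof.
move=> n0 cB tI AD e0.
have [mB /(continuous_multilinear_bounded n0 mB)[M M0 BM]] := cB.
have tD j : exists R : K, forall x, D j x -> `|t j x| <= R.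
  have bD := adm_bounded hA (adm_image hA (AD j) (tI j).1).
  have [R DR] : exists R : K, globally (t j @` D j) [set y | `|y| <= R] :=
    @filter_ex _ (pinfty_nbhs K) _ _ bD.
  by exists R => x Dx; apply: DR; exists x.
have [R tR] := choice tD.
(* Absolute values are summed because [R j] may fail to be nonnegative when [D j] is empty. *)
pose r : K := 1 + \sum_j `|R j|.
have r1 : 1 <= r by rewrite lerDl sumr_ge0.
have tr j x : D j x -> `|t j x| <= r.
  move=> Dx; have Rx := tR j x Dx.
  rewrite (le_trans Rx)// -[leLHS]ger0_norm ?(le_trans _ Rx)//.
  by rewrite /r (bigD1 j)//= addrCA lerDl addr_ge0// sumr_ge0.
pose c := n%:R * (M * (r + 1) ^+ n).
have r0 : 0 <= r + 1 by rewrite addr_ge0// (le_trans _ r1).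
have r11 : 1 <= r + 1 by rewrite lerDr (le_trans _ r1).
have c0 : 0 <= c by rewrite mulr_ge0// mulr_ge0 ?exprn_ge0// ltW.
have ce : 0 < c + e by rewrite ltr_wpDl.
(* [d <= 1] keeps the approximants below [r + 1] on the sets [D j], and [c * d <= e] bounds the
   total error. *)
pose d := e / (c + e).
have d0 : 0 < d by rewrite divr_gt0.
have d1 : d <= 1 by rewrite ler_pdivrMr// mul1r lerDr.
pose u j := s2val (cid2 (tau_closure_approx (tI j) (AD j) d0)).
exists (fun x => B (fun j => u j (x j))).
  by exists E, u, B; split => // j; exact: s2valP.
move=> x Dx.
have tu j : `|t j (x j) - u j (x j)| <= d.
  by apply/ltW; apply: (s2valP' (cid2 (tau_closure_approx (tI j) (AD j) d0))).
rewrite (@le_trans _ _ (n%:R * (M * (d * (r + 1) ^+ n))))//.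
  apply: (multilinear_dist mB) => // j.
  - by rewrite (le_trans (tr _ _ (Dx j)))// lerDl.
  - rewrite -[u j _](subrK (t j (x j))) (le_trans (ler_normD _ _))// addrC.
    by rewrite lerD ?tr// distrC (le_trans (tu j)).
rewrite (mulrCA M) (mulrCA _ d) -/c /d mulrAC -mulrA ger_pMr//.
by rewrite ler_pdivrMr// mul1r lerDl ltW.
Qed.

End Approximation.

(** * Finite unions in a directed assignment *)

Section Directed.
Context {K : numFieldType} {A : assignment K} {E : banach K}.
Hypothesis A_nonempty : exists D, A E D.
Hypothesis A_directed : forall A1 A2 : set E,
  A E A1 -> A E A2 -> exists2 A3, A E A3 & A1 `|` A2 `<=` A3.

Lemma directed_bigcup {m : nat} (D : 'I_m -> set E) :
  (forall i, A E (D i)) -> exists2 D', A E D' & forall i, D i `<=` D'.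
Proof.
move=> AD; suff [D' AD' DD'] : exists2 D', A E D' &
    forall i, i \in enum 'I_m -> D i `<=` D'.
  by exists D' => // i; apply: DD'; rewrite mem_enum.
elim: (enum 'I_m) => [|i s [D1 AD1 sD1]].
  by have [D0 AD0] := A_nonempty; exists D0.
have [D2 AD2 D12] := A_directed _ _ (AD i) AD1.
exists D2 => // j; rewrite in_cons => /predU1P[->|/sD1 jD1] x Dx; apply: D12.
  by left.
by right; exact: jD1.
Qed.

End Directed.

(** * The weak approximation property of the tensor product *)

Lemma proj_tensor_WAP {K : numFieldType} {n : nat}
  {C : banach K -> Prop} {A : assignment K}
  (hA : admissible C A)
  (hA_directed : forall (E : banach K) (A1 A2 : set E),
     A E A1 -> A E A2 -> exists2 A3, A E A3 & A1 `|` A2 `<=` A3)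
  {I J : op_class K} {In Jn : 'I_n -> op_class K}
  (hI : operator_ideal I) (hJ : operator_ideal J)
  (hfactor : forall (E : 'I_n -> banach K) (F : banach K),
     @factor_ideal _ n In E F `<=` @comp_ideal _ (tau_closure A I) n E F)
  {E : 'I_n -> banach K} (hC : exists j, C (E j))
  {T : banach K} {phi : (forall j, E j) -> T}
  (hT : is_proj_tensor phi)
  (hJ_tensor : @comp_ideal _ J n E T `<=` @tensor_ideal _ n Jn E T)
  (hWAP : forall j, WAP (Jn j) (In j) A (E j)) :
  WAP J I A T.
Proof.
have A_ne (F : banach K) : exists D, A F D.
  by exists [set 0]; exact: (adm_singleton hA).
have n0 : (0 < n)%N by have [j _] := hC; exact: leq_ltn_trans (ltn_ord j).
move=> v Jv; have bv := ideal_bounded hJ Jv.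
apply: (approx_tau_closure (A_ne T) (hA_directed T) bv) => D e AD e0.
have e20 : 0 < e / 2 by rewrite divr_gt0.
have [|t [B [Jt cB vphi]]] := hJ_tensor (v \o phi).
  by exists T, phi, v; split => //; exact: proj_tensor_continuous.
have [m [D' [AD' DD']]] := adm_tensor_sub hA hC hT AD.
(* For each [j] the finitely many sets [D' i j] are merged into one, so that a single approximant
   [b] serves all the hulls. *)
pose H j := cid2 (directed_bigcup (A_ne (E j)) (hA_directed (E j)) _
  (fun i => AD' i j)).
pose D1 j := s2val (H j).
have AD1 j : A (E j) (D1 j) := s2valP (H j).
have DD1 i j : D' i j `<=` D1 j := s2valP' (H j) i.
have [b /hfactor[G [B' [w [cB' tw bE]]]] Bb] :=
  factor_ideal_approx hA n0 cB (fun j => hWAP j _ (Jt j)) AD1 e20.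
have [L [bL Lphi]] := proj_tensor_linearization hT _ n0 cB'.
have [g Ig wg] := tau_closure_approx tw (adm_image hA AD bL) e20.
exists (id \o g \o L); first exact: (ideal_comp hI bL Ig bounded_op_id).
move=> x Dx; rewrite (splitr e).
have [i _ Di] := DD' _ Dx.
(* The intermediate point is [w (L x)]: the hull estimate bounds its distance to [v x], the choice
   of [g] its distance to [g (L x)]. *)
rewrite (le_lt_trans (ler_distD (w (L x)) _ _))// ler_ltD//; last first.
  by apply: wg; exists x.
have bg := bounded_op_sub bv (bounded_op_comp bL tw.1).
apply: (bounded_op_hull bg _ _ Di) => _ [y D'y <-] /=.
rewrite Lphi -[w _]/((w \o B') y) -bE -[v _]/((v \o phi) y) vphi.
by apply: Bb => j; exact: DD1 (D'y j).
Qed.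

Theorem theorem4p20 (R : realType) (k : scalar_kind) (n : nat)
  (C : banach (scalars R k) -> Prop) (A : assignment (scalars R k))
  (hA : admissible C A)
  (hA_directed : forall (E : banach (scalars R k)) (A1 A2 : set E),
     A E A1 -> A E A2 -> exists2 A3, A E A3 & A1 `|` A2 `<=` A3)
  (I J : op_class (scalars R k)) (In Jn : 'I_n -> op_class (scalars R k))
  (hI : operator_ideal I) (hJ : operator_ideal J)
  (hIn : forall j, operator_ideal (In j))
  (hJn : forall j, operator_ideal (Jn j))
  (hfactor : forall (E : 'I_n -> banach (scalars R k))
     (F : banach (scalars R k)),
     @factor_ideal _ n In E F `<=` @comp_ideal _ (tau_closure A I) n E F)
  (E : 'I_n -> banach (scalars R k)) (hC : exists j, C (E j))
  (T : banach (scalars R k)) (phi : (forall j, E j) -> T)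
  (hT : is_proj_tensor phi)
  (hJ_tensor : @comp_ideal _ J n E T `<=` @tensor_ideal _ n Jn E T)
  (hWAP : forall j, WAP (Jn j) (In j) A (E j)) :
  WAP J I A T.
Proof.
exact: (proj_tensor_WAP hA hA_directed hI hJ hfactor hC hT hJ_tensor hWAP).
Qed.
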